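(* Let $\mathcal H$ be a real separable Hilbert space, let $T:\mathcal H\to\mathcal H$ be $\alpha$-averaged for some $\alpha\in(0,1]$ with $\operatorname{fix}T\neq\emptyset$, and let $R=\mathrm{id}-T$. Consider the iterates $(x_k)_{k\in\mathbb N}$ generated by the General Framework (described in the context), and suppose that for all $k$ it is always possible to find a point $x_{k+1}$ complying with the requirements of either step 2, step 3(a) or step 3(b), and further satisfying, for some constant $D\ge 0$, $$\|x_{k+1}-x_k\|\le D\|Rx_k\|\qquad\forall k\in K_0\cup K_1 .$$ Suppose further that $(x_k)_{k\in\mathbb N}$ converges strongly to a point $x_\star$ (this being true if $\mathcal H$ is finite dimensional) at which $R$ is metrically subregular. Then $(x_k)_{k\in\mathbb N}$ and $(Rx_k)_{k\in\mathbb N}$ are $R$-linearly convergent.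
   Context: An operator $T$ is nonexpansive if $\|Tx-Ty\|\le\|x-y\|$ for all $x,y\in\mathcal H$; it is $\alpha$-averaged, $\alpha\in(0,1)$, if $T=(1-\alpha)\mathrm{id}+\alpha S$ for some nonexpansive $S:\mathcal H\to\mathcal H$; $1$-averaged means nonexpansive. $\operatorname{fix}T=\{z: Tz=z\}$, $\operatorname{zer}R=\{z:Rz=0\}=\operatorname{fix}T$. $R$ is metrically subregular at $\bar x\in\operatorname{zer}R$ if there exist $\varepsilon,\gamma>0$ such that $\operatorname{dist}(x,\operatorname{zer}R)\le\gamma\|Rx\|$ for all $x$ with $\|x-\bar x\|<\varepsilon$. A sequence $(u_k)$ converging to $u$ is $R$-linearly convergent if there are $C>0$, $r\in(0,1)$ with $\|u_k-u\|\le Cr^k$ for all $k$. General Framework. Parameters: $x_0\in\mathcal H$, $c_0,c_1,q\in[0,1)$, $\sigma>0$. Initialize $\eta_0=r_{\rm safe}=\|Rx_0\|$, $k=0$. Step 1. If $Rx_k=0$, stop. Step 2 (blind update). If $\|Rx_k\|\le c_0\eta_k$, set $\eta_{k+1}=\|Rx_k\|$, choose $x_{k+1}$ arbitrarily, and go to step 4. Step 3. Otherwise set $\eta_{k+1}=\eta_k$ and select $x_{k+1}$ such that (a) (educated update) either the safe condition $\|Rx_k\|\le r_{\rm safe}$ holds and $\|Rx_{k+1}\|\le c_1\|Rx_k\|$, in which case update $r_{\rm safe}=\|Rx_{k+1}\|+q^k$; (b) (safeguard update) or $\|x_{k+1}-z\|^2\le\|x_k-z\|^2-\sigma\|Rx_k\|^2$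 for all $z\in\operatorname{fix}T$. Step 4. Set $k\gets k+1$ and go to step 1. $K_0,K_1,K_2\subseteq\mathbb N$ denote the sets of iteration indices $k$ at which $x_{k+1}$ is produced by step 2, 3(a), 3(b) respectively. Standing assumption: a solution is not found in finitely many steps, i.e. $Rx_k\ne0$ for all $k$, so infinitely many iterates are generated. *)

(* Defs.v *)
From HB Require Import structures.
From mathcomp Require Import all_boot all_order all_algebra.
From mathcomp Require Import all_classical all_reals all_analysis.

Set Implicit Arguments.
Unset Strict Implicit.
Unset Printing Implicit Defensive.

Import Order.TTheory GRing.Theory Num.Theory.
Import numFieldNormedType.Exports.

Local Open Scope classical_set_scope.
Local Open Scope ring_scope.

(* A real Hilbert space is a complete normed module whose norm comes from
   an inner product; positive definiteness, symmetry and bilinearity are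
   part of the type of [dot]. *)
Definition norm_induced_by (R : realType) (H : normedModType R)
    (dot : {dot H for idfun}) : Prop :=
  forall x : H, `|x| ^+ 2 = dot x x.

Definition separable_space (H : topologicalType) : Prop :=
  exists2 S : set H, countable S & dense S.

Definition finite_dimensional (R : realType) (H : lmodType R) : Prop :=
  exists (n : nat) (e : 'I_n -> H),
    forall v : H, exists a : 'I_n -> R, v = \sum_(i < n) a i *: e i.

Definition nonexpansive (R : realType) (H : normedModType R) (T : H -> H) :
    Prop :=
  forall x y : H, `|T x - T y| <= `|x - y|.

Definition averaged (R : realType) (H : normedModType R) (alpha : R)
    (T : H -> H) : Prop :=
  (0 < alpha < 1 /\
   exists2 S : H -> H, nonexpansive S &
     forall x : H, T x = (1 - alpha) *: x + alpha *: S x) \/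
  (alpha = 1 /\ nonexpansive T).

Definition fix_set (H : Type) (T : H -> H) : set H := [set z | T z = z].

Definition zer (H : zmodType) (A : H -> H) : set H := [set z | A z = 0].

Definition residual (H : zmodType) (T : H -> H) : H -> H := fun x => x - T x.

(* Only used for nonempty [A]: on the empty set [inf] returns 0. *)
Definition dist (R : realType) (H : normedModType R) (x : H) (A : set H) : R :=
  inf [set `|x - z| | z in A].

Definition metrically_subregular (R : realType) (H : normedModType R)
    (A : H -> H) (xbar : H) : Prop :=
  zer A xbar /\
  exists eps gamma : R, [/\ 0 < eps, 0 < gamma &
    forall x : H, `|x - xbar| < eps -> dist x (zer A) <= gamma * `|A x|].

Definition R_linearly_convergent (R : realType) (H : normedModType R)
    (u : nat -> H) : Prop :=
  exists2 l : H, u @ \oo --> l &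
    exists C r : R, [/\ 0 < C, 0 < r < 1 &
      forall k : nat, `|u k - l| <= C * r ^+ k].

(* The rule by which x_{k+1} is produced: step 2, 3(a) or 3(b). *)
Inductive update := Blind | Educated | Safeguard.

(* One pass through steps 2 to 4. [eta], [rsafe] are the values held on
   entering the iteration and [eta'], [rsafe'] those held on leaving it;
   [x] is the current iterate, [x'] the next one, [k] the iteration index
   (with the convention [q ^+ 0 = 1], also for [q = 0]). When both 3(a) and
   3(b) are available, either may be selected. *)
Definition framework_step (R : realType) (H : normedModType R) (T : H -> H)
    (c0 c1 q sigma : R) (k : nat) (u : update)
    (x : H) (eta rsafe : R) (x' : H) (eta' rsafe' : R) : Prop :=
  let Res := residual T in
  match u with
  | Blind =>
      [/\ `|Res x| <= c0 * eta, eta' = `|Res x| & rsafe' = rsafe]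
  | Educated =>
      ~ (`|Res x| <= c0 * eta) /\
      [/\ eta' = eta, `|Res x| <= rsafe, `|Res x'| <= c1 * `|Res x| &
          rsafe' = `|Res x'| + q ^+ k]
  | Safeguard =>
      ~ (`|Res x| <= c0 * eta) /\
      [/\ eta' = eta, rsafe' = rsafe &
          forall z : H, fix_set T z ->
            `|x' - z| ^+ 2 <= `|x - z| ^+ 2 - sigma * `|Res x| ^+ 2]
  end.

(* [x], [eta], [rsafe], [u] record an infinite run: [eta k] and [rsafe k] are
   the values of the variables when iteration [k] starts, and [u k] is the
   rule producing [x k.+1]. The stopping test of step 1 never succeeds. *)
Record general_framework (R : realType) (H : normedModType R) (T : H -> H)
    (c0 c1 q sigma : R) (x : nat -> H) (eta rsafe : nat -> R)
    (u : nat -> update) : Prop := {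
  framework_eta0 : eta 0%N = `|residual T (x 0%N)|;
  framework_rsafe0 : rsafe 0%N = `|residual T (x 0%N)|;
  framework_continue : forall k : nat, residual T (x k) <> 0;
  framework_next : forall k : nat,
    framework_step T c0 c1 q sigma k (u k)
      (x k) (eta k) (rsafe k) (x k.+1) (eta k.+1) (rsafe k.+1)
}.

Definition K0 (u : nat -> update) : set nat := [set k | u k = Blind].
Definition K1 (u : nat -> update) : set nat := [set k | u k = Educated].

(* Main.v *)
Require Import Defs.
From HB Require Import structures.
From mathcomp Require Import all_boot all_order all_algebra.
From mathcomp Require Import all_classical all_reals all_analysis.
From mathcomp Require Import ring lra.
Import Order.TTheory GRing.Theory Num.Theory.
Import numFieldNormedType.Exports.
Local Open Scope classical_set_scope.
Local Open Scope ring_scope.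

(** Write [r k] for the residual norm at [x k] and [d k] for the distance from
    [x k] to the fixed points of [T].

    Convergence in finite dimension. Blind updates consume [eta], educated
    updates consume [rsafe] up to the summable terms [q ^+ k], and safeguard
    updates touch neither. Hence a linear combination [W] of [eta], [rsafe] and
    the tail of the geometric series drops by at least [r k] at every blind or
    educated update ([framework_budget]). The jumps there are at most [D * r k],
    so for each fixed point [z] the quantity [`|x k - z| + D * W k] never
    increases; both [W k] and [`|x k - z|] therefore converge, and the
    decrements force [r k] to 0 ([framework_dist_cvg]). A cluster point, which
    exists for a bounded sequence in finite dimension, is then a fixed point,
    and the convergence of [`|x k - z|] makes it the limit
    ([framework_cluster_cvg]).

    Linear rate. Since no residual vanishes, subregularity can be
    extended from the tail to all iterates, at the cost of a larger constant:
    [d k <= g * r k], while always [r k <= 2 * d k]. Safeguard updates then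
    contract [d] by a fixed factor, and the other updates multiply [d] by at
    most a constant [M], which may exceed 1. This growth is harmless: after [m] blind, [n]
    educated and [p] safeguard updates, [eta] is of order [th ^+ m] and [rsafe]
    of order [th ^+ n], so the most recent blind or educated update resets [d]
    to one of these orders. A weighted geometric mean of the resulting
    estimates decays geometrically in [m + n + p]
    ([mixed_geometric_bounds], [geometric_decay_of_updates]). Every step has
    length at most a multiple of [d k], hence the iterates converge at the same
    geometric rate, and so do the residuals because the residual map is
    Lipschitz ([framework_R_linear]). *)

Set Implicit Arguments.
Unset Strict Implicit.
Unset Printing Implicit Defensive.

(** * Geometric rates *)

Lemma expr_eventually_small (R : realType) (th A e : R) :
  0 < th < 1 -> 0 < A -> 0 < e -> exists W : nat, A * th ^+ W <= e.
Proof.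
move=> /andP[th0 th1] A0 e0.
have thlt1 : `|th| < 1 by rewrite gtr0_norm.
have /cvgrPdist_le/(_ (e / A)) := cvg_expr thlt1.
rewrite divr_gt0// => /(_ isT)[N _ /(_ N (leqnn N))].
rewrite /= sub0r normrN ger0_norm ?exprn_ge0 ?(ltW th0)// => h.
by exists N; rewrite mulrC -ler_pdivlMr.
Qed.

Lemma bernoulli_one_minus (R : realType) (t : R) (n : nat) :
  0 <= t <= 1 -> 1 - n%:R * t <= (1 - t) ^+ n.
Proof.
move=> /andP[t0 t1]; elim: n => [|n IH]; first by rewrite mul0r subr0 expr0.
rewrite exprS; apply: le_trans (ler_wpM2l _ IH); last by rewrite subr_ge0.
rewrite -natr1 -subr_ge0.
have -> : (1 - t) * (1 - n%:R * t) - (1 - (n%:R + 1) * t) = n%:R * t * t by ring.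
by rewrite !mulr_ge0.
Qed.

(** Taking logarithms, each growth factor [M] is outweighed by enough copies of
    an estimate in which the corresponding exponent only contributes decay: [W2]
    copies of the second estimate absorb the [M ^+ n] of the third, and [W1]
    copies of the first absorb all the powers [M ^+ m]. The product bounds
    [y ^+ (W1 + W2 + 1)] by [th ^+ (m + n + p)], and the root of [th] is
    replaced by the larger explicit number [1 - (1 - th) / (W1 + W2 + 1)]. *)
Lemma mixed_geometric_bounds (R : realType) (th M : R) :
  0 < th < 1 -> 1 <= M ->
  exists2 lam : R, 0 < lam < 1 & forall (y : R) (m n p : nat), 0 <= y ->
    y <= th ^+ m -> y <= M ^+ m * th ^+ n ->
    y <= M ^+ (m + n) * th ^+ p -> y <= lam ^+ (m + n + p).
Proof.
move=> th01 M1; have /andP[th0 th1] := th01.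
have M0 : 0 < M by exact: (lt_le_trans ltr01 M1).
have [W2 hW2] := expr_eventually_small th01 M0 th0.
have [W1 hW1] := expr_eventually_small th01 (mulr_gt0 M0 (exprn_gt0 W2 M0)) th0.
pose W := (W1 + W2 + 1)%N.
have W0 : 0 < W%:R :> R by rewrite ltr0n /W addn1.
have W1' : 1 <= W%:R :> R by rewrite ler1n /W addn1.
pose t := (1 - th) / W%:R.
have t0 : 0 < t by rewrite divr_gt0// subr_gt0.
have t1 : t < 1 by rewrite ltr_pdivrMr// mul1r; lra.
have lamW : th <= (1 - t) ^+ W.
  have := @bernoulli_one_minus R t W; rewrite (ltW t0) (ltW t1) => /(_ isT).
  by rewrite mulrC divfK ?gt_eqF// subKr.
exists (1 - t) => [|y m n p y0 y1 y2 y3]; first by apply/andP; split; lra.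
rewrite -(@ler_pXn2r _ W) ?nnegrE ?exprn_ge0//; last 2 first.
- by rewrite /W addn1.
- by rewrite subr_ge0 ltW.
rewrite exprAC; apply: (@le_trans _ _ (th ^+ (m + n + p))); last first.
  by rewrite lerXn2r// nnegrE ?exprn_ge0// ?subr_ge0 ?ltW.
have -> : y ^+ W = y ^+ W1 * y ^+ W2 * y by rewrite /W !exprD expr1.
apply: (@le_trans _ _ ((th ^+ m) ^+ W1 * (M ^+ m * th ^+ n) ^+ W2
                        * (M ^+ (m + n) * th ^+ p))).
  apply: ler_pM => //; first by rewrite mulr_ge0 ?exprn_ge0.
  apply: ler_pM; rewrite ?exprn_ge0//.
  - by rewrite lerXn2r ?nnegrE ?exprn_ge0 ?(ltW th0).
  - by rewrite lerXn2r ?nnegrE ?mulr_ge0 ?exprn_ge0 ?(ltW th0) ?(ltW M0).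
have -> : (th ^+ m) ^+ W1 * (M ^+ m * th ^+ n) ^+ W2
                        * (M ^+ (m + n) * th ^+ p) =
   (M * M ^+ W2 * th ^+ W1) ^+ m * (M * th ^+ W2) ^+ n * th ^+ p.
  rewrite !exprMn !exprD -!exprM.
  by rewrite (mulnC m W1) (mulnC m W2) (mulnC n W2); ring.
rewrite !exprD.
apply: ler_pM => //; rewrite ?mulr_ge0 ?exprn_ge0 ?mulr_ge0 ?exprn_ge0 ?(ltW th0) ?(ltW M0)//.
by apply: ler_pM; rewrite ?mulr_ge0 ?exprn_ge0 ?mulr_ge0 ?exprn_ge0 ?(ltW th0) ?(ltW M0)//;
   rewrite lerXn2r ?nnegrE ?mulr_ge0 ?exprn_ge0 ?mulr_ge0 ?exprn_ge0 ?(ltW th0) ?(ltW M0).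
Qed.

(** With [m], [n], [p] the numbers of blind, educated and safeguard updates so
    far, the induction carries four bounds on [d]: each of [th ^+ m] and
    [th ^+ n] spoilt by a factor [M] for every update of the other kind, one of
    the two unspoilt, according to which of these updates came last, and
    [th ^+ p] spoilt by [M] at every blind or educated update. The unspoilt
    bound is what [mixed_geometric_bounds] needs: the two spoilt ones alone
    would not give decay when [m] and [n] are comparable. *)
Lemma geometric_decay_of_updates (R : realType) (c0 c1 q th0 th M : R)
    (d r eta rsafe : nat -> R) (u : nat -> update) :
  0 <= c0 <= th0 -> 0 <= c1 <= th0 -> 0 <= q <= th0 ->
  0 < th0 < th -> th < 1 -> 1 <= M ->
  (forall k, 0 <= d k) -> 
  0 <= eta 0%N ->
  (forall k, d k.+1 <= M * d k) ->
  (forall k, match u k with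
   | Blind => [/\ r k <= c0 * eta k, eta k.+1 = r k, rsafe k.+1 = rsafe k
                & d k.+1 <= M * r k]
   | Educated => [/\ eta k.+1 = eta k, r k <= rsafe k,
                   rsafe k.+1 <= c1 * r k + q ^+ k & d k.+1 <= M * r k]
   | Safeguard => [/\ eta k.+1 = eta k, rsafe k.+1 = rsafe k
                    & d k.+1 <= th0 * d k]
   end) ->
  exists C lam : R, [/\ 0 < C, 0 < lam < 1 & forall k, d k <= C * lam ^+ k].
Proof.
move=> /andP[c00 c0th] /andP[c10 c1th] /andP[q0 qth] /andP[th00 thlt] th1 M1
  dge0 eta0 dM run.
have th0' : 0 < th by exact: lt_trans thlt.
have th01 : 0 < th < 1 by rewrite th0'.
have M0 : 0 < M by exact: (lt_le_trans ltr01 M1).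
pose A := eta 0%N.
(* A multiple of [th ^+ n] dominates [rsafe] once [th0 * B + 1 <= B * th]: the
   extra 1 pays for [q ^+ k], and this is why [th] exceeds [th0] strictly. *)
pose B := `|rsafe 0%N| + (th - th0)^-1.
have dth : 0 < th - th0 by rewrite subr_gt0.
have B0 : 0 <= B by rewrite addr_ge0// invr_ge0 ltW.
have hB : th0 * B + 1 <= B * th.
  rewrite -subr_ge0 (_ : _ - _ = B * (th - th0) - 1); last by ring.
  by rewrite /B mulrDl mulVf ?gt_eqF// addrK mulr_ge0// ltW.
pose C := d 0%N + M * A + M * B / th + 1.
have MA0 : 0 <= M * A by rewrite mulr_ge0// ltW.
have MB0 : 0 <= M * B / th by rewrite divr_ge0 ?mulr_ge0// ltW.
have C0 : 0 < C by rewrite /C; have := dge0 0%N; lra.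
have CA : M * A <= C by rewrite /C; have := dge0 0%N; lra.
have CB : M * B <= C * th.
  by rewrite -ler_pdivrMr// /C; have := dge0 0%N; lra.
have [lam lam01 hlam] := mixed_geometric_bounds th01 M1.
exists C, lam; split => // k.
have thX i : 0 < th ^+ i by rewrite exprn_gt0.
have MX i : 1 <= M ^+ i by rewrite exprn_ege1.
have MCX a b : 0 <= C * (M ^+ a * th ^+ b).
  by rewrite !mulr_ge0 ?exprn_ge0// ltW.
have CX b : 0 <= C * th ^+ b by rewrite mulr_ge0// ltW.
have lift a b : C * th ^+ b <= C * (M ^+ a * th ^+ b).
  by rewrite ler_pM2l// ler_peMl// ltW.
have up a b : M * (C * (M ^+ a * th ^+ b)) = C * (M ^+ a.+1 * th ^+ b).
  by rewrite (exprS M); ring.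
have [m [n [p [-> _ _ [h1 h2 h3 h4]]]]] : exists m n p : nat,
  [/\ k = (m + n + p)%N, eta k <= A * th ^+ m, rsafe k <= B * th ^+ n &
   [/\ d k <= C * (M ^+ n * th ^+ m), d k <= C * (M ^+ m * th ^+ n),
    d k <= C * th ^+ m \/ d k <= C * th ^+ n &
    d k <= C * (M ^+ (m + n) * th ^+ p)]].
  elim: k => [|k [m [n [p [kE etak rk [h1 h2 h3 h4]]]]]].
    exists 0%N, 0%N, 0%N; rewrite !expr0 !mulr1.
    have d0 : d 0%N <= C by rewrite /C; lra.
    split => //; last by split => //; left.
    apply: le_trans (ler_norm _) _.
    by rewrite lerDl invr_ge0 ltW.
  have dMk := dM k.
  have dup a b : d k <= C * (M ^+ a * th ^+ b) ->
      d k.+1 <= C * (M ^+ a.+1 * th ^+ b).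
    by move=> h; rewrite -up; apply: le_trans dMk _; rewrite ler_pM2l.
  have := run k; case: (u k).
  - move=> [rle -> -> dr]; exists m.+1, n, p.
    have rk' : r k <= A * th ^+ m.+1.
      rewrite exprS mulrCA; apply: le_trans rle _.
      have e0 : 0 <= A * th ^+ m by rewrite mulr_ge0// ltW.
      have := ler_wpM2l c00 etak.
      have := ler_wpM2r e0 (le_trans c0th (ltW thlt)); lra.
    have dk' : d k.+1 <= C * th ^+ m.+1.
      apply: le_trans dr _; apply: le_trans (ler_wpM2l (ltW M0) rk') _.
      by rewrite mulrA ler_pM2r.
    split => //; [by rewrite kE !addSn|split; last exact: dup].
    + by apply: le_trans (lift _ _).
    + exact: dup.
    + by left.
  - move=> [-> rle rs dr]; exists m, n.+1, p.
    have e0 : 0 <= B * th ^+ n by rewrite mulr_ge0// ltW.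
    have rk' : r k <= B * th ^+ n by exact: le_trans rk.
    have dk' : d k.+1 <= C * th ^+ n.+1.
      apply: le_trans dr _; apply: le_trans (ler_wpM2l (ltW M0) rk') _.
      by rewrite mulrA exprS mulrA ler_pM2r.
    have qk : q ^+ k <= th ^+ n.
      apply: (@le_trans _ _ (th ^+ k)).
        by rewrite lerXn2r ?nnegrE// ?(ltW th0')// (le_trans qth) ?ltW.
      by apply: ler_wiXn2l; rewrite ?ltW// kE addnAC leq_addl.
    split => //; first by rewrite kE addnS addSn.
      apply: le_trans rs _; rewrite exprS.
      have := ler_wpM2l c10 rk'; have := ler_wpM2r e0 c1th.
      have := ler_wpM2r (ltW (thX n)) hB; lra.
    split; last by rewrite addnS; apply: dup.
    + exact: dup.
    + by apply: le_trans (lift _ _).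
    + by right.
  - move=> [-> -> ds]; exists m, n, p.+1.
    have dk' : d k.+1 <= th * d k.
      by apply: le_trans ds _; rewrite ler_wpM2r// ltW.
    have dd : d k.+1 <= d k.
      by apply: le_trans dk' _; rewrite ler_piMl// ltW.
    split => //; [by rewrite kE addnS|split; first by exact: le_trans h1].
    + by exact: le_trans h2.
    + by case: h3 => h3; [left|right]; exact: le_trans h3.
    + apply: le_trans dk' _; apply: le_trans (ler_wpM2l (ltW th0') h4) _.
      by rewrite exprS le_eqVlt; apply/orP; left; apply/eqP; ring.
set k' := (m + n + p)%N in h1 h2 h3 h4 *.
have y0 : 0 <= d k' / C by rewrite divr_ge0// ltW.
have scale z : d k' <= C * z -> d k' / C <= z by rewrite ler_pdivrMr// (mulrC z).
suff : d k' / C <= lam ^+ k' by rewrite ler_pdivrMr// (mulrC (lam ^+ _)).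
case: h3 => h3; first by apply: hlam => //; exact: scale.
rewrite {2}/k' (addnC m n); apply: hlam => //; apply: scale => //.
by rewrite (addnC n m).
Qed.

(** The witness has [1 - t] below its square because
    [(1 - t / 2) ^+ 2 = 1 - t + (t / 2) ^+ 2]; [t] is first capped at 1 to keep
    the witness positive. *)
Lemma common_rate (R : realType) (c0 c1 q t : R) :
  0 <= c0 < 1 -> 0 <= c1 < 1 -> 0 <= q < 1 -> 0 < t ->
  exists th : R, [/\ 0 < th < 1, c0 <= th, c1 <= th, q <= th &
    1 - t <= th ^+ 2].
Proof.
move=> /andP[c00 c01] /andP[c10 c11] /andP[q0 q1] t0.
pose t' := Num.min t 1.
have t'0 : 0 < t' by rewrite lt_min t0 ltr01.
have t't : t' <= t by rewrite ge_min lexx.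
have t'1 : t' <= 1 by rewrite ge_min lexx orbT.
pose s := 1 - t' / 2.
have s0 : 0 < s by rewrite /s; lra.
pose th := Num.max s (Num.max c0 (Num.max c1 q)).
have sth : s <= th by rewrite le_max lexx.
exists th; split; rewrite ?le_max ?lexx ?orbT//.
  by rewrite !lt_max !gt_max s0 c01 c11 q1 !andbT /s; lra.
apply: (@le_trans _ _ (s ^+ 2)).
  have -> : s ^+ 2 = 1 - t' + (t' / 2) ^+ 2 by rewrite /s; field.
  by have := sqr_ge0 (t' / 2); lra.
by rewrite lerXn2r// nnegrE ltW// (lt_le_trans s0).
Qed.

(** Only finitely many ratios [d k / r k] escape the tail estimate. Used to make
    a local error bound hold along the whole run. *)
Lemma eventual_ratio_bound (R : realType) (d r : nat -> R) (gamma : R) (N : nat) :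
  (forall k, 0 < r k) -> (forall k, (N <= k)%N -> d k <= gamma * r k) ->
  exists2 g : R, 0 < g & forall k, d k <= g * r k.
Proof.
move=> r0 h; pose g := \big[Num.max/1]_(i < N) (d i / r i).
have g1 : 1 <= g by rewrite bigmax_ge_id.
exists (Num.max gamma g); first by rewrite lt_max (lt_le_trans ltr01 g1) orbT.
move=> k; have [/h hk|kN] := leqP N k.
  by apply: le_trans hk _; rewrite ler_pM2r// le_max lexx.
rewrite -ler_pdivrMr// le_max; apply/orP; right.
exact: (le_bigmax _ (fun i : 'I_N => d i / r i) (Ordinal kN)).
Qed.

Lemma fejer_decrease_le (R : realType) (sigma a b r : R) :
  0 < sigma -> 0 <= b -> a ^+ 2 <= b ^+ 2 - sigma * r ^+ 2 -> a <= b.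
Proof.
move=> s0 b0 h; rewrite leNgt; apply/negP => ba.
have : b ^+ 2 < a ^+ 2 by rewrite ltr_pXn2r ?nnegrE// ltW// (le_lt_trans b0).
by have := mulr_ge0 (ltW s0) (sqr_ge0 r); lra.
Qed.

Lemma cvg_decrements_small (R : realType) (u : nat -> R) (e : R) :
  cvgn u -> 0 < e -> \forall k \near \oo, u k - u k.+1 <= e.
Proof.
move=> ucvg e0; have e2 : 0 < e / 2 by rewrite divr_gt0.
have /cvgrPdist_le/(_ _ e2)[N _ hN] := ucvg.
exists N => // k /= Nk; have := hN k Nk; have := hN k.+1 (leqW Nk).
rewrite !ler_norml => /andP[a1 a2] /andP[b1 b2]; lra.
Qed.

Lemma nonincreasing_nonneg_cvgn (R : realType) (u : nat -> R) :
  (forall k, 0 <= u k) -> (forall k, u k.+1 <= u k) -> cvgn u.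
Proof.
move=> u0 ud; apply: nonincreasing_is_cvgn; last by exists 0 => _ [k _ <-].
exact/nonincreasing_seqP.
Qed.

Lemma geometric_bound_R_linear (R : realType) (H : normedModType R)
    (u : nat -> H) (l : H) (C lam : R) : 0 < C -> 0 < lam < 1 ->
  (forall k, `|u k - l| <= C * lam ^+ k) -> R_linearly_convergent u.
Proof.
move=> C0 lam01 h; have /andP[l0 l1] := lam01; exists l; last by exists C, lam.
have : (fun k => C * lam ^+ k) @ \oo --> C * 0.
  by apply: cvgMr; apply: cvg_expr; rewrite gtr0_norm.
rewrite mulr0 => h0; apply/cvgrPdist_le => e e0.
have /cvgrPdist_le/(_ e e0) := h0; apply: filterS => k.
rewrite sub0r normrN ger0_norm; last by rewrite mulr_ge0 ?exprn_ge0// ltW.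
by rewrite distrC; exact: le_trans.
Qed.

(** By telescoping, [`|x (k + j) - x k|] is at most
    [K / (1 - lam) * (lam ^+ k - lam ^+ (k + j))]; then [j] tends to infinity. *)
Lemma geometric_steps_error (R : realType) (H : normedModType R)
    (x : nat -> H) (l : H) (K lam : R) : 0 < lam < 1 ->
  x @ \oo --> l -> (forall k, `|x k.+1 - x k| <= K * lam ^+ k) ->
  forall k, `|x k - l| <= K / (1 - lam) * lam ^+ k.
Proof.
move=> /andP[l0 l1] xl hx k.
have d0 : 0 < 1 - lam by rewrite subr_gt0.
have K0 : 0 <= K.
  by have := le_trans (normr_ge0 _) (hx 0%N); rewrite expr0 mulr1.
pose C := K / (1 - lam).
have C0 : 0 <= C by rewrite divr_ge0// ltW.
have KE : K = C * (1 - lam) by rewrite /C divfK ?gt_eqF.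
have tele j : `|x (k + j)%N - x k| <= C * lam ^+ k - C * lam ^+ (k + j).
  elim: j => [|j IH]; first by rewrite addn0 !subrr normr0.
  apply: le_trans (ler_distD (x (k + j)%N) _ _) _.
  rewrite addnS; have := hx (k + j)%N; rewrite KE exprS; lra.
apply/ler_addgt0Pr => e e0.
have /cvgrPdist_le/(_ e e0)[N _ /(_ (k + N)%N)] := xl.
rewrite /= leq_addl => /(_ isT) hN.
apply: le_trans (ler_distD (x (k + N)%N) _ _) _.
have := tele N; rewrite distrC => hk.
rewrite lerD//; last by rewrite distrC.
by apply: le_trans hk _; rewrite gerBl mulr_ge0// exprn_ge0// ltW.
Qed.

(** * Residuals and distances to sets *)

Lemma averaged_nonexpansive (R : realType) (H : normedModType R) (alpha : R)
    (T : H -> H) : averaged alpha T -> nonexpansive T.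
Proof.
move=> [[/andP[a0 a1] [S hS hT]]|[_ //]] x y.
have -> : T x - T y = (1 - alpha) *: (x - y) + alpha *: (S x - S y).
  by rewrite !hT !scalerBr opprD addrACA.
apply: le_trans (ler_normD _ _) _; rewrite !normrZ.
rewrite (ger0_norm (ltW a0)) ger0_norm ?subr_ge0; last exact: ltW.
by have := ler_wpM2l (ltW a0) (hS x y); lra.
Qed.

Lemma residual_lipschitz (R : realType) (H : normedModType R) (T : H -> H)
    (x y : H) : nonexpansive T ->
  `|residual T x - residual T y| <= 2 * `|x - y|.
Proof.
move=> /(_ x y) hT.
have -> : residual T x - residual T y = (x - y) - (T x - T y).
  by rewrite /residual !opprB [LHS]addrACA [RHS]addrACA (addrC (- T x)).
by apply: le_trans (ler_normB _ _) _; lra.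
Qed.

Lemma zer_residual (H : zmodType) (T : H -> H) : zer (residual T) = fix_set T.
Proof.
apply/seteqP; split=> z /=; rewrite /residual /zer /fix_set /=.
- by move/eqP; rewrite subr_eq0 => /eqP.
- by move=> ->; rewrite subrr.
Qed.

Lemma dist_le (R : realType) (H : normedModType R) (x z : H) (A : set H) :
  A z -> dist x A <= `|x - z|.
Proof.
move=> Az; apply: ge_inf; last by exists z.
by exists 0 => _ [y _ <-].
Qed.

Lemma dist_ge (R : realType) (H : normedModType R) (x : H) (A : set H) (a : R) :
  A !=set0 -> (forall z, A z -> a <= `|x - z|) -> a <= dist x A.
Proof.
move=> [z Az] h; apply: lb_le_inf; first by exists `|x - z|, z.
by move=> _ [y Ay <-]; exact: h.
Qed.

Lemma dist_triangle (R : realType) (H : normedModType R) (x y : H) (A : set H) :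
  A !=set0 -> dist y A <= dist x A + `|y - x|.
Proof.
move=> A0; rewrite -lerBlDr; apply: dist_ge => // z Az.
rewrite lerBlDr; apply: le_trans (dist_le _ Az) _.
by rewrite [leRHS]addrC; exact: ler_distD.
Qed.

(** Taking the infimum over [z] turns the pointwise decrease into
    [dist x' F ^+ 2 + sigma * r ^+ 2 <= dist x F ^+ 2], and the error bound
    [dist x F <= g * r] makes the subtracted term a fixed proportion of
    [dist x F ^+ 2]. *)
Lemma fejer_dist_contraction (R : realType) (H : normedModType R)
    (F : set H) (x x' : H) (sigma g th r : R) :
  F !=set0 -> 0 < sigma -> 0 < g -> 0 < th -> 0 <= r ->
  1 - sigma / g ^+ 2 <= th ^+ 2 -> dist x F <= g * r ->
  (forall z, F z -> `|x' - z| ^+ 2 <= `|x - z| ^+ 2 - sigma * r ^+ 2) ->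
  dist x' F <= th * dist x F.
Proof.
move=> F0 s0 g0 th0 r0 hth dg hx.
have d0 y : 0 <= dist y F by apply: dist_ge.
pose m := dist x' F ^+ 2 + sigma * r ^+ 2.
have m0 : 0 <= m by rewrite addr_ge0 ?sqr_ge0// mulr_ge0 ?sqr_ge0// ltW.
have md : Num.sqrt m <= dist x F.
  apply: dist_ge => // z Fz.
  rewrite -(ger0_norm (normr_ge0 (x - z))) -sqrtr_sqr ler_wsqrtr//.
  have : dist x' F ^+ 2 <= `|x' - z| ^+ 2.
    by rewrite ler_pXn2r ?nnegrE//; exact: dist_le.
  have := hx z Fz; rewrite /m; lra.
have md2 : m <= dist x F ^+ 2.
  by rewrite -(sqr_sqrtr m0) ler_pXn2r ?nnegrE ?sqrtr_ge0.
have dr : sigma / g ^+ 2 * dist x F ^+ 2 <= sigma * r ^+ 2.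
  have -> : sigma * r ^+ 2 = sigma / g ^+ 2 * (g * r) ^+ 2.
    by field; rewrite gt_eqF.
  rewrite ler_pM2l ?divr_gt0 ?exprn_gt0// ler_pXn2r ?nnegrE//.
  by rewrite mulr_ge0// ltW.
rewrite -(@ler_pXn2r _ 2) ?nnegrE// ?mulr_ge0 ?(ltW th0)// exprMn.
have := ler_wpM2r (sqr_ge0 (dist x F)) hth; move: md2; rewrite /m; lra.
Qed.

(** * Bounded sequences in finite dimension *)

Lemma dotC (R : realType) (H : normedModType R) (dot : {dot H for idfun})
    (v w : H) : dot v w = dot w v.
Proof. by rewrite hermC expr0 mul1r. Qed.

(** Bessel's inequality for one unit vector: [dot v v - dot v f ^+ 2] is the
    squared norm of [v - dot v f *: f]. *)
Lemma dot_le_norm (R : realType) (H : normedModType R)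
    (dot : {dot H for idfun}) (v f : H) :
  norm_induced_by dot -> dot f f = 1 -> `|dot v f| <= `|v|.
Proof.
move=> hdot ff; rewrite -ler_sqr ?nnegrE// (real_normK (num_real (dot v f))) hdot -subr_ge0.
have -> : dot v v - dot v f ^+ 2 =
    dot (v - dot v f *: f) (v - dot v f *: f).
  rewrite !(linearBl, linearBr) !linearZl_LR !linearZr_LR /= ff.
  by rewrite (dotC dot f v) /GRing.scale /=; ring.
by rewrite -hdot sqr_ge0.
Qed.

(** The second clause, orthogonality of the remainder [v - P v] to [t], stands
    in for pairwise orthogonality: it is preserved when a normalized remainder
    is added to [t], and together with unit norms it makes [P] the orthogonal
    projection on the span of [t]. *)
Lemma gram_schmidt (R : realType) (H : normedModType R)
    (dot : {dot H for idfun}) (hdot : norm_induced_by dot) (s : seq H) :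
  exists t : seq H, [/\ forall f, f \in t -> dot f f = 1,
    forall v h, h \in t -> dot (v - \sum_(f <- t) dot v f *: f) h = 0 &
    forall e, e \in s -> \sum_(f <- t) dot e f *: f = e].
Proof.
elim: s => [|e s [t [t1 tort ts]]]; first by exists [::].
pose w := e - \sum_(f <- t) dot e f *: f.
have [w0|w0] := eqVneq w 0.
  exists t; split=> // e'; rewrite inE => /orP[/eqP->|/ts//].
  by apply/esym/eqP; rewrite -subr_eq0; apply/eqP.
have nw0 : `|w| != 0 by rewrite normr_eq0.
pose g := `|w|^-1 *: w.
have gt h : h \in t -> dot h g = 0.
  by move=> ht; rewrite dotC linearZl_LR /= tort// mulr0.
have gg : dot g g = 1.
  by rewrite linearZl_LR linearZr_LR /= -hdot expr2 mulKf// mulVf.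
have Pg v : dot (\sum_(f <- t) dot v f *: f) g = 0.
  rewrite linear_sumlz big1_seq// => f /andP[_ ft].
  by rewrite linearZl_LR /= gt// mulr0.
exists (g :: t); split.
- by move=> f; rewrite inE => /orP[/eqP->|/t1].
- move=> v h; rewrite inE big_cons opprD addrCA linearDl linearNl linearZl_LR /=.
  move=> /orP[/eqP->|ht]; first by rewrite linearBl /= Pg gg subr0 mulr1 addNr.
  by rewrite tort// (dotC dot g h) gt// mulr0 oppr0 addr0.
- move=> e'; rewrite inE big_cons => /orP[/eqP->|e's].
    have -> : dot e g *: g = w.
      have -> : dot e g = dot w g by rewrite /w linearBl /= Pg subr0.
      by rewrite linearZr_LR /= -hdot expr2 mulKf// scalerA mulfV// scale1r.
    by rewrite subrK.
  have -> : dot e' g = 0 by rewrite -(ts e' e's) Pg.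
  by rewrite scale0r add0r ts.
Qed.

(** The expansion identity is linear in [v] and holds on a spanning family. *)
Lemma finite_dimensional_orthonormal_frame (R : realType) (H : normedModType R)
    (dot : {dot H for idfun}) (hdot : norm_induced_by dot) :
  finite_dimensional H -> exists t : seq H,
    (forall f, f \in t -> dot f f = 1) /\
    forall v, v = \sum_(f <- t) dot v f *: f.
Proof.
move=> [n [e he]].
have [t [t1 _ ts]] := gram_schmidt hdot (codom e).
exists t; split=> // v; have [a ->] := he v.
under [RHS]eq_bigr do rewrite linear_sumlz scaler_suml.
rewrite exchange_big; apply: eq_bigr => i _ /=.
under eq_bigr do rewrite linearZl_LR /= -scalerA.
by rewrite -scaler_sumr ts// codom_f.
Qed.

(** The coordinates of a bounded sequence in an orthonormal frame stay in a box,
    so the sequence stays in the continuous image of a compact set. *)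
Lemma finite_dimensional_bounded_cluster (R : realType) (H : normedModType R)
    (dot : {dot H for idfun}) (hdot : norm_induced_by dot)
    (x : nat -> H) (M : R) :
  finite_dimensional H -> (forall k, `|x k| <= M) ->
  exists z : H, cluster (x @ \oo) z.
Proof.
move=> /(finite_dimensional_orthonormal_frame hdot)[t [t1 tv]] xM.
pose phi (a : 'rV[R]_(size t)) : H := \sum_(i < size t) a ord0 i *: t`_i.
have phic : continuous phi.
  apply: continuous_big => [|i _ a]; first exact: add_continuous.
  apply: (@cvgZr_tmp _ _ _ _ (nbhs_filter a)).
  exact: coord_continuous.
pose box := [set a : 'rV[R]_(size t) | forall i, `[- M, M]%classic (a ord0 i)].
have boxc : compact box.
  by apply: (@rV_compact _ _ (fun=> `[- M, M]%classic)) => _; exact: segment_compact.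
have phiboxc : compact (phi @` box).
  by apply: continuous_compact => //; exact: continuous_subspaceT.
have [z [_ zc]] : phi @` box `&` cluster (x @ \oo) !=set0.
  apply: phiboxc; exists 0%N => // k _ /=.
  exists (\row_i dot (x k) t`_i).
    move=> i; rewrite mxE /= in_itv /= -ler_norml.
    by apply: le_trans (xM k); apply: dot_le_norm => //; apply: t1; exact: mem_nth.
  rewrite [RHS]tv (big_nth 0) big_mkord /phi.
  by apply: eq_bigr => i _; rewrite mxE.
by exists z.
Qed.

(** * Convergence of the framework *)

Lemma framework_eta_rsafe_ge0 (R : realType) (H : normedModType R) (T : H -> H)
    (c0 c1 q sigma : R) (x : nat -> H) (eta rsafe : nat -> R)
    (u : nat -> update) :
  0 <= q -> general_framework T c0 c1 q sigma x eta rsafe u ->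
  forall k, 0 <= eta k /\ 0 <= rsafe k.
Proof.
move=> q0 [eta0 rs0 _ run]; elim=> [|k [IH1 IH2]]; first by rewrite eta0 rs0.
have := run k; rewrite /framework_step; case: (u k).
- by move=> [_ -> ->].
- by move=> [_ [-> _ _ ->]]; rewrite addr_ge0// exprn_ge0.
- by move=> [_ [-> -> _]].
Qed.

(** With [r] the residual norm, the weights come from three identities. For
    [a = c0 / (1 - c0)], replacing [eta] by [r <= c0 * eta] leaves
    [r + a * r <= a * eta]. For [b = 1 / (1 - c1)], replacing [rsafe >= r] by
    [c1 * r + q ^+ k] leaves [r + b * c1 * r = b * r <= b * rsafe]. The term
    [q ^+ k / (1 - q)] is the tail of the geometric series, which loses exactly
    [q ^+ k] at index [k]. *)
Lemma framework_budget (R : realType) (H : normedModType R) (T : H -> H)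
    (c0 c1 q sigma : R) (x : nat -> H) (eta rsafe : nat -> R)
    (u : nat -> update) :
  0 <= c0 < 1 -> 0 <= c1 < 1 -> 0 <= q < 1 ->
  general_framework T c0 c1 q sigma x eta rsafe u ->
  exists W : nat -> R, (forall k, 0 <= W k) /\
    forall k, W k.+1 <= W k /\
      (u k <> Safeguard -> W k.+1 + `|residual T (x k)| <= W k).
Proof.
move=> /andP[c00 c01] /andP[c10 c11] /andP[q0 q1] hrun.
have eta_rs := framework_eta_rsafe_ge0 q0 hrun.
case: hrun => _ _ _ run.
have d0 : 0 < 1 - c0 by rewrite subr_gt0.
have d1 : 0 < 1 - c1 by rewrite subr_gt0.
have dq : 0 < 1 - q by rewrite subr_gt0.
pose a := c0 / (1 - c0); pose b := (1 - c1)^-1.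
have a0 : 0 <= a by rewrite divr_ge0// ltW.
have b0 : 0 <= b by rewrite invr_ge0 ltW.
have aE : a * (1 - c0) = c0 by rewrite /a divfK ?gt_eqF.
have bE : b * (1 - c1) = 1 by rewrite /b mulVf ?gt_eqF.
pose g k := q ^+ k / (1 - q).
have g0 k : 0 <= g k by rewrite divr_ge0 ?exprn_ge0// ltW.
have gE k : g k = g k.+1 + q ^+ k.
  by rewrite /g exprS; field; rewrite gt_eqF.
have gd k : b * g k.+1 <= b * g k.
  by apply: ler_wpM2l => //; rewrite (gE k) lerDl exprn_ge0.
exists (fun k => a * eta k + b * (rsafe k + g k)); split => k.
  by have [? ?] := eta_rs k; rewrite addr_ge0// mulr_ge0// addr_ge0.
suff : match u k with
       | Safeguard => 0 | _ => `|residual T (x k)| end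
    <= a * eta k + b * (rsafe k + g k)
       - (a * eta k.+1 + b * (rsafe k.+1 + g k.+1)).
  have rr := normr_ge0 (residual T (x k)).
  by case: (u k) => h; split => // *; lra.
have gdk := gd k; have gEk := gE k.
have := run k; rewrite /framework_step; case: (u k).
- move=> [hr -> ->]; set r := `|_| in hr *.
  (* r <= c0 eta gives (1 + a) r <= a eta, because a = (1 + a) c0 *)
  have h : (1 + a) * r <= (1 + a) * (c0 * eta k) by rewrite ler_wpM2l// addr_ge0.
  have e : (1 + a) * (c0 * eta k) = a * eta k.
    by rewrite mulrA; congr (_ * _); rewrite mulrDl mul1r -{1}aE; ring.
  lra.
- move=> [_ [-> hr hr' ->]]; set r := `|residual T (x k)| in hr hr' *.
  set r' := `|_| in hr' *.
  have h1 := ler_wpM2l b0 hr; have h2 := ler_wpM2l b0 hr'.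
  have e : r = b * r - b * (c1 * r) by rewrite -[LHS]mul1r -bE; ring.
  rewrite gEk; lra.
- move=> [_ [-> -> _]]; lra.
Qed.

Lemma framework_fejer_step (R : realType) (H : normedModType R) (T : H -> H)
    (c0 c1 q sigma : R) (x : nat -> H) (eta rsafe : nat -> R)
    (u : nat -> update) (z : H) (k : nat) :
  general_framework T c0 c1 q sigma x eta rsafe u -> fix_set T z ->
  u k = Safeguard -> `|x k.+1 - z| ^+ 2 <=
    `|x k - z| ^+ 2 - sigma * `|residual T (x k)| ^+ 2.
Proof.
by move=> [_ _ _ /(_ k)] run zfix uk; move: run; rewrite uk => -[_ [_ _]]; exact.
Qed.

(** [`|x k - z| + D * W k] is nonincreasing, for [W] the budget of
    [framework_budget]; with [W] convergent too, so is [`|x k - z|]. At each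
    index the residual is controlled by a decrement of a convergent sequence:
    [W] at blind and educated updates, [`|x k - z| ^+ 2] at safeguard ones. *)
Lemma framework_dist_cvg (R : realType) (H : normedModType R) (T : H -> H)
    (c0 c1 q sigma : R) (x : nat -> H) (eta rsafe : nat -> R)
    (u : nat -> update) (D : R) (z : H) :
  0 <= c0 < 1 -> 0 <= c1 < 1 -> 0 <= q < 1 -> 0 < sigma -> 0 <= D ->
  general_framework T c0 c1 q sigma x eta rsafe u ->
  (forall k : nat, (K0 u `|` K1 u) k ->
       `|x k.+1 - x k| <= D * `|residual T (x k)|) ->
  fix_set T z -> cvgn (fun k => `|x k - z|) /\
  forall e : R, 0 < e -> \forall k \near \oo, `|residual T (x k)| <= e.
Proof.
move=> hc0 hc1 hq s0 D0 hrun hstep zfix.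
have [W [W0 hW]] := framework_budget hc0 hc1 hq hrun.
have Wcvg : cvgn W.
  by apply: nonincreasing_nonneg_cvgn => // k; case: (hW k).
pose V := fun k => `|x k - z| + D * W k.
have Vcvg : cvgn V.
  apply: nonincreasing_nonneg_cvgn => k; first by rewrite addr_ge0// mulr_ge0.
  have [Wd WD] := hW k; rewrite /V.
  have jump : (K0 u `|` K1 u) k -> u k <> Safeguard ->
      `|x k.+1 - z| + D * W k.+1 <= `|x k - z| + D * W k.
    move=> /hstep hk /WD h.
    have := ler_distD (x k) (x k.+1) z; have := ler_wpM2l D0 h; lra.
  case uk : (u k).
  - by apply: jump; [left|rewrite uk].
  - by apply: jump; [right|rewrite uk].
  - apply: lerD; last exact: ler_wpM2l.
    apply: (fejer_decrease_le s0 (normr_ge0 _)).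
    exact: (framework_fejer_step hrun zfix uk).
have acvg : cvgn (fun k => `|x k - z|).
  have -> : (fun k => `|x k - z|) = (fun k => V k - D * W k).
    by apply/funext => k; rewrite /V addrK.
  apply: is_cvgB => //; apply: is_cvgM => //; exact: is_cvg_cst.
split=> // e e0.
have a2cvg : cvgn (fun k => `|x k - z| ^+ 2).
  by under eq_fun do rewrite expr2; apply: is_cvgM.
have se : 0 < sigma * e ^+ 2 by rewrite mulr_gt0// exprn_gt0.
near=> k.
have Wk : W k - W k.+1 <= e by near: k; exact: cvg_decrements_small.
have ak : `|x k - z| ^+ 2 - `|x k.+1 - z| ^+ 2 <= sigma * e ^+ 2.
  by near: k; exact: (cvg_decrements_small a2cvg se).
have small : u k <> Safeguard -> `|residual T (x k)| <= e.
  by move=> /(proj2 (hW k)) h; lra.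
case uk : (u k); [by apply: small; rewrite uk..|].
have h := framework_fejer_step hrun zfix uk.
rewrite -ler_sqr ?nnegrE ?(ltW e0)// -(ler_pM2l s0); lra.
Unshelve. all: by end_near. Qed.

(** The residual at [z] is small because it is close to that of iterates near
    [z], so [z] is a fixed point; then [`|x k - z|] converges, and its limit is 0
    because it is small infinitely often. *)
Lemma framework_cluster_cvg (R : realType) (H : normedModType R) (T : H -> H)
    (c0 c1 q sigma : R) (x : nat -> H) (eta rsafe : nat -> R)
    (u : nat -> update) (D : R) (z : H) :
  0 <= c0 < 1 -> 0 <= c1 < 1 -> 0 <= q < 1 -> 0 < sigma -> 0 <= D ->
  nonexpansive T -> fix_set T !=set0 ->
  general_framework T c0 c1 q sigma x eta rsafe u ->
  (forall k : nat, (K0 u `|` K1 u) k ->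
       `|x k.+1 - x k| <= D * `|residual T (x k)|) ->
  cluster (x @ \oo) z -> x @ \oo --> z.
Proof.
move=> hc0 hc1 hq s0 D0 hT [z0 z0fix] hrun hstep zc.
have main z' (hz : fix_set T z') :=
  framework_dist_cvg hc0 hc1 hq s0 D0 hrun hstep hz.
have often (P : set nat) (e : R) : 0 < e -> (\forall k \near \oo, P k) ->
    exists2 k, P k & `|x k - z| < e.
  move=> e0 hP.
  have [_ [[k Pk <-]]] := zc (x @` P) (ball z e) (filterS (fun k Pk => ex_intro2 _ _ k Pk erefl) hP) (nbhsx_ballx z e e0).
  by rewrite -ball_normE /= distrC => h; exists k.
have zfix : fix_set T z.
  rewrite -zer_residual /zer /=; apply/eqP; rewrite -normr_le0.
  apply/ler_addgt0Pr => e e0; rewrite add0r.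
  have e3 : 0 < e / 3 by rewrite divr_gt0.
  have [k rk xk] := often _ _ e3 ((main z0 z0fix).2 _ e3).
  have hl := residual_lipschitz z (x k) hT.
  have := lerB_normD (residual T z - residual T (x k)) (residual T (x k)).
  have := ler_normD (residual T z - residual T (x k)) (residual T (x k)).
  move: hl; rewrite subrK (distrC z); lra.
have [/cvgrPdist_le dcvg _] := main z zfix.
apply/cvgrPdist_le => e e0; have e3 : 0 < e / 3 by rewrite divr_gt0.
have hd := dcvg _ e3.
have [k0 hk0 xk0] := often _ _ e3 hd.
apply: filterS hd => k; move: hk0.
rewrite /= (distrC z) !ler_norml => /andP[a1 a2] /andP[b1 b2]; lra.
Qed.

(** * Linear rate under metric subregularity *)

(** Applies [geometric_decay_of_updates] to the distances to the zeros of the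
    residual, then sums the steps, each of length at most [B * d k]. *)
Lemma framework_R_linear (R : realType) (H : normedModType R) (T : H -> H)
    (c0 c1 q sigma : R) (x : nat -> H) (eta rsafe : nat -> R)
    (u : nat -> update) (D : R) (xstar : H) :
  0 <= c0 < 1 -> 0 <= c1 < 1 -> 0 <= q < 1 -> 0 < sigma -> 0 <= D ->
  nonexpansive T ->
  general_framework T c0 c1 q sigma x eta rsafe u ->
  (forall k : nat, (K0 u `|` K1 u) k ->
       `|x k.+1 - x k| <= D * `|residual T (x k)|) ->
  x @ \oo --> xstar -> metrically_subregular (residual T) xstar ->
  R_linearly_convergent x /\ R_linearly_convergent (fun k => residual T (x k)).
Proof.
move=> hc0 hc1 hq s0 D0 hT hrun hstep xcvg [xzer [eps [gamma [eps0 _ hsub]]]].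
pose F := zer (residual T); pose d k := dist (x k) F.
pose r k := `|residual T (x k)|.
have F0 : F !=set0 by exists xstar.
have r0 k : 0 < r k.
  by rewrite normr_gt0; apply/eqP; exact: (framework_continue hrun).
have d0 k : 0 <= d k by exact: dist_ge.
have rd k : r k <= 2 * d k.
  rewrite -ler_pdivrMl// mulrC; apply: dist_ge => // z Fz.
  have := residual_lipschitz (x k) z hT; rewrite Fz subr0 -/(r k); lra.
have [g g0 dr] : exists2 g : R, 0 < g & forall k, d k <= g * r k.
  have /cvgrPdist_lt/(_ _ eps0)[N _ hN] := xcvg.
  apply: (@eventual_ratio_bound _ d r gamma N) => // k Nk.
  by apply: hsub; rewrite distrC; exact: hN.
have t0 : 0 < sigma / g ^+ 2 by rewrite divr_gt0// exprn_gt0.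
have [th [/andP[th0 th1] c0th c1th qth hth]] := common_rate hc0 hc1 hq t0.
have /andP[c00 _] := hc0; have /andP[c10 _] := hc1; have /andP[q0 _] := hq.
have safe k : u k = Safeguard -> forall z, F z ->
    `|x k.+1 - z| ^+ 2 <= `|x k - z| ^+ 2 - sigma * r k ^+ 2.
  move=> uk z Fz; apply: (framework_fejer_step hrun _ uk).
  by rewrite -zer_residual.
have dsafe k : u k = Safeguard -> d k.+1 <= th * d k.
  move=> uk; apply: (fejer_dist_contraction F0 s0 g0 th0 _ hth (dr k)).
    exact: ltW.
  exact: safe.
pose B := 2 * D + 2.
have step k : `|x k.+1 - x k| <= B * d k.
  have jump : (K0 u `|` K1 u) k -> `|x k.+1 - x k| <= B * d k.
    move=> /hstep; rewrite -/(r k) => h.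
    have := ler_wpM2l D0 (rd k); have := d0 k; rewrite /B; lra.
  case uk : (u k); [by apply: jump; left|by apply: jump; right|].
  (* A safeguard update moves no farther than twice the distance to any zero. *)
  have : `|x k.+1 - x k| / 2 <= d k.
    apply: dist_ge => // z Fz.
    have := fejer_decrease_le s0 (normr_ge0 _) (safe k uk z Fz).
    have := ler_distD z (x k.+1) (x k); rewrite (distrC z); lra.
  have := mulr_ge0 D0 (d0 k); rewrite /B; lra.
pose M := 1 + 2 * D + g.
have dtri k : d k.+1 <= d k + `|x k.+1 - x k| by exact: dist_triangle.
have jumpr k : (K0 u `|` K1 u) k -> d k.+1 <= M * r k.
  move=> /hstep; rewrite -/(r k) => h.
  have := dtri k; have := dr k; have := mulr_ge0 D0 (ltW (r0 k)).
  have := ltW (r0 k); rewrite /M; lra.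
have jumpd k : d k.+1 <= M * d k.
  have Dd := mulr_ge0 D0 (d0 k); have gd := mulr_ge0 (ltW g0) (d0 k).
  have jump : (K0 u `|` K1 u) k -> d k.+1 <= M * d k.
    move=> /hstep; rewrite -/(r k) => h.
    have := dtri k; have := ler_wpM2l D0 (rd k); rewrite /M; lra.
  case uk : (u k); [by apply: jump; left|by apply: jump; right|].
  have := dsafe k uk; have := ler_wpM2r (d0 k) (ltW th1); rewrite /M; lra.
have [C [lam [C0 lam01 dC]]] : exists C lam : R,
    [/\ 0 < C, 0 < lam < 1 & forall k, d k <= C * lam ^+ k].
  apply: (@geometric_decay_of_updates _ c0 c1 q th ((1 + th) / 2) M
            d r eta rsafe u) => //.
  - exact/andP.
  - exact/andP.
  - exact/andP.
  - by rewrite th0 /=; lra.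
  - by lra.
  - by rewrite /M; lra.
  - by rewrite (framework_eta0 hrun).
  move=> k; have := framework_next hrun k.
  rewrite /framework_step -/(r k); case uk : (u k).
  - by move=> [h1 h2 h3]; split => //; apply: jumpr; left.
  - move=> [_ [h1 h2 h3 ->]]; split => //; last by apply: jumpr; right.
    by rewrite lerD2r.
  - by move=> [_ [h1 h2 _]]; split => //; exact: dsafe.
have B0 : 0 < B by rewrite /B; lra.
have /andP[lam0 lam1] := lam01.
pose E := B * C / (1 - lam).
have E0 : 0 < E by rewrite divr_gt0 ?mulr_gt0// subr_gt0.
have xE k : `|x k - xstar| <= E * lam ^+ k.
  apply: geometric_steps_error => // j.
  by apply: le_trans (step j) _; rewrite -mulrA ler_pM2l.
split; first exact: (geometric_bound_R_linear E0 lam01 xE).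
apply: (@geometric_bound_R_linear _ _ _ 0 (2 * E) lam) => //.
  by rewrite mulr_gt0.
move=> k; rewrite subr0 -mulrA; have := residual_lipschitz (x k) xstar hT.
rewrite xzer subr0; have := xE k; lra.
Qed.

Unset Implicit Arguments.
Set Strict Implicit.

Theorem mainTheorem2 (R : realType) (H : completeNormedModType R)
    (dot : {dot H for idfun}) (hdot : norm_induced_by dot)
    (hsep : separable_space H)
    (alpha : R) (halpha : 0 < alpha <= 1)
    (T : H -> H) (hT : averaged alpha T) (hfix : fix_set T !=set0)
    (c0 c1 q sigma : R) (hc0 : 0 <= c0 < 1) (hc1 : 0 <= c1 < 1)
    (hq : 0 <= q < 1) (hsigma : 0 < sigma)
    (x : nat -> H) (eta rsafe : nat -> R) (u : nat -> update)
    (hrun : general_framework T c0 c1 q sigma x eta rsafe u)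
    (D : R) (hD : 0 <= D)
    (hstep : forall k : nat, (K0 u `|` K1 u) k ->
       `|x k.+1 - x k| <= D * `|residual T (x k)|) :
  (finite_dimensional H -> exists xstar : H, x @ \oo --> xstar) /\
  (forall xstar : H, x @ \oo --> xstar ->
     metrically_subregular (residual T) xstar ->
     R_linearly_convergent x /\
     R_linearly_convergent (fun k => residual T (x k))).
Proof.
have ne := averaged_nonexpansive hT.
split=> [fdim|xstar xcvg msub]; last first.
  exact: (framework_R_linear hc0 hc1 hq hsigma hD ne hrun hstep xcvg msub).
have [z0 z0fix] := hfix.
have [dcvg _] := framework_dist_cvg hc0 hc1 hq hsigma hD hrun hstep z0fix.
have [M xM] : exists M : R, forall k, `|x k| <= M.
  have /cvg_seq_bounded[K [_ /(_ (K + 1))]] := dcvg.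
  rewrite ltrDl ltr01 => /(_ isT) hK; exists (K + 1 + `|z0|) => k.
  rewrite -[x k](subrK z0); apply: le_trans (ler_normD _ _) _.
  by rewrite lerD2r; have := hK k I; rewrite /= normr_id.
have [z zc] := finite_dimensional_bounded_cluster hdot fdim xM.
by exists z; apply: (framework_cluster_cvg hc0 hc1 hq hsigma hD ne hfix hrun hstep).
Qed.
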